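(* Let $\mu$ be a purely atomic measure on $(E,\mathcal E)$ where all the atoms are singletons. (a) $(\widetilde{\mathcal E},d_\mu)$ is compact if and only if $\sum_{x\in E_{fin}}\mu(\{x\})$ is finite and $E_\infty$ is finite. (b) $(\widetilde{\mathcal E}_{fin},d_\mu)$ is compact if and only if $\sum_{x\in E_{fin}}\mu(\{x\})$ is finite.
   Context: A set $A\in\mathcal E$ is an atom of $\mu$ if $0<\mu(A)<\infty$ and for every $C\subset A$ with $C\in\mathcal E$, either $\mu(C)=0$ or $\mu(C)=\mu(A)$. The measure $\mu$ is purely atomic if there is a collection $\mathcal C$ of atoms of $\mu$ such that for each $A\in\mathcal E$, $\mu(A)$ is the sum of the numbers $\mu(C)$ over all $C\in\mathcal C$ such that $\mu(A\cap C)=\mu(C)$. Define $E_{fin}=\{x\in E:0<\mu(\{x\})<\infty\}$ (the set of all atoms with finite measure) and $E_\infty=\{x\in E:\mu(\{x\})=\infty\}$ (the set of all atoms with infinite measure). For $A\in\mathcal E$ let $[A]=\{B\in\mathcal E:\mu(A\Delta B)=0\}$, where $\Delta$ is symmetric difference, $\widetilde{\mathcal E}=\{[A]:A\in\mathcal E\}$ and $\widetilde{\mathcal E}_{fin}=\{[A]:A\in\mathcal E,\ \mu(A)<\infty\}$, with the metric (possibly taking the value $\infty$ on $\widetilde{\mathcal E}$) $d_\mu([A],[B])=\mu(A\Delta B)^{1/2}$ and the topology it generates. *)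

(* Defs.v *)
From HB Require Import structures.
From mathcomp Require Import all_boot all_order all_algebra.
From mathcomp Require Import all_classical all_reals all_analysis.
Set Implicit Arguments.
Unset Strict Implicit.
Unset Printing Implicit Defensive.
Import Order.TTheory GRing.Theory Num.Theory.
Local Open Scope classical_set_scope.
Local Open Scope ring_scope.
Local Open Scope ereal_scope.

(* Atoms of infinite measure are allowed here, since the points of [E_inf]
   are meant to be atoms; [finite_atom] is the notion with 0 < mu A < +oo. *)
Definition atom (d : measure_display) (T : measurableType d) (R : realType)
    (mu : {measure set T -> \bar R}) (A : set T) : Prop :=
  [/\ measurable A, 0 < mu A &
      forall C, measurable C -> C `<=` A -> mu C = 0 \/ mu C = mu A].

Definition finite_atom (d : measure_display) (T : measurableType d)
    (R : realType) (mu : {measure set T -> \bar R}) (A : set T) : Prop :=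
  atom mu A /\ mu A < +oo.

Definition sums_over (d : measure_display) (T : measurableType d)
    (R : realType) (mu : {measure set T -> \bar R}) (CC : set (set T)) : Prop :=
  forall A, measurable A ->
    mu A = \esum_(C in [set C | CC C /\ mu (A `&` C) = mu C]) mu C.

(* The atoms that make [mu] purely atomic can all be taken to be singletons.
   Atoms outside of the collection are not constrained: {x} `|` N with N null,
   and {x} `|` {y} with both points of infinite measure, are atoms too. *)
Definition purely_atomic_singletons (d : measure_display)
    (T : measurableType d) (R : realType) (mu : {measure set T -> \bar R}) :
    Prop :=
  exists CC : set (set T),
    [/\ CC `<=` atom mu, forall C, CC C -> exists x, C = [set x] &
        sums_over mu CC].

Lemma purely_atomic_singletonsW (d : measure_display) (T : measurableType d)
    (R : realType) (mu : {measure set T -> \bar R}) :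
  (exists2 CC, CC `<=` finite_atom mu & sums_over mu CC) ->
  (forall A, finite_atom mu A -> exists x, A = [set x]) ->
  purely_atomic_singletons mu.
Proof.
move=> [CC CCat CCsum] single; exists CC; split => //.
- by move=> C /CCat[].
- by move=> C /CCat /single.
Qed.

(* Singletons need not be measurable in general, and library measures take
   arbitrary values on nonmeasurable sets. *)
Definition E_fin (d : measure_display) (T : measurableType d) (R : realType)
    (mu : {measure set T -> \bar R}) : set T :=
  [set x | measurable [set x] /\ 0 < mu [set x] < +oo].

Definition E_inf (d : measure_display) (T : measurableType d) (R : realType)
    (mu : {measure set T -> \bar R}) : set T :=
  [set x | measurable [set x] /\ mu [set x] = +oo].

Definition ae_class (d : measure_display) (T : measurableType d)
    (R : realType) (mu : {measure set T -> \bar R}) (A : set T) :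
    set (set T) :=
  [set B | measurable B /\ mu (A `+` B) = 0].

Definition measure_algebra (d : measure_display) (T : measurableType d)
    (R : realType) (mu : {measure set T -> \bar R}) : Type :=
  {X : set (set T) | X \in [set ae_class mu A | A in measurable]}.

HB.instance Definition _ (d : measure_display) (T : measurableType d)
    (R : realType) (mu : {measure set T -> \bar R}) :=
  Choice.on (measure_algebra mu).

Definition class_of (d : measure_display) (T : measurableType d)
    (R : realType) (mu : {measure set T -> \bar R}) (A : set T)
    (mA : measurable A) : measure_algebra mu :=
  exist _ (ae_class mu A) (mem_set (imageP (ae_class mu) mA)).

Definition class_repr (d : measure_display) (T : measurableType d)
    (R : realType) (mu : {measure set T -> \bar R})
    (X : measure_algebra mu) : set T := xget set0 (val X).

(* Independent of the representatives: see [d_muE]. *)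
Definition d_mu (d : measure_display) (T : measurableType d) (R : realType)
    (mu : {measure set T -> \bar R}) (X Y : measure_algebra mu) : \bar R :=
  sqrte (mu (class_repr X `+` class_repr Y)).

Lemma sqrte_le_add (R : realType) (a b c : \bar R) :
  0 <= a -> 0 <= b -> 0 <= c -> a <= b + c -> sqrte a <= sqrte b + sqrte c.
Proof.
case: a b c => [a| |] [b| |] [c| |] //=; rewrite ?leey //.
rewrite !lee_fin => a0 b0 c0 abc.
rewrite -ler_sqr ?nnegrE ?addr_ge0 ?sqrtr_ge0 // sqrrD !sqr_sqrtr //.
by rewrite (le_trans abc)// lerD2r lerDl mulrn_wge0// mulr_ge0 ?sqrtr_ge0.
Qed.

Section d_mu_theory.
Context (d : measure_display) (T : measurableType d) (R : realType).
Variable mu : {measure set T -> \bar R}.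
Implicit Types (A B C : set T) (X Y Z : measure_algebra mu).

Lemma measurable_setY A B :
  measurable A -> measurable B -> measurable (A `+` B).
Proof. by move=> mA mB; apply: measurableU; exact: measurableD. Qed.

Lemma measure_setY_triangle A B C :
  measurable A -> measurable B -> measurable C ->
  mu (A `+` C) <= mu (A `+` B) + mu (B `+` C).
Proof.
move=> mA mB mC.
apply: (le_trans _ (measureU2 _ _ _)); try exact: measurable_setY.
apply: le_measure; rewrite ?inE; first exact: measurable_setY.
  by apply: measurableU; exact: measurable_setY.
move=> x; rewrite /setY /=; case: (pselect (B x)); tauto.
Qed.

Lemma class_reprP X : measurable (class_repr X) /\
  val X = ae_class mu (class_repr X).
Proof.
case: X => X PX; rewrite /class_repr /=.
move: (set_mem PX) => [A mA AX]; rewrite -AX.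
have [mB AB] : ae_class mu A (xget set0 (ae_class mu A)).
  by apply: (@xgetI _ _ _ A); split => //; rewrite setYK measure0.
set B := xget _ _ in mB AB *; split=> //.
apply/seteqP; split => C [mC hC]; split => //; apply/eqP;
  rewrite -measure_le0.
- rewrite (le_trans (measure_setY_triangle mB mA mC))//.
  by rewrite setYC AB hC adde0.
- rewrite (le_trans (measure_setY_triangle mA mB mC))//.
  by rewrite AB hC adde0.
Qed.

Lemma d_muE A B (mA : measurable A) (mB : measurable B) :
  d_mu (class_of mu mA) (class_of mu mB) = sqrte (mu (A `+` B)).
Proof.
rewrite /d_mu; congr sqrte.
have [mA' eA] := class_reprP (class_of mu mA).
have [mB' eB] := class_reprP (class_of mu mB).
move: eA eB; rewrite /=.
set A' := class_repr _ in mA' *; set B' := class_repr _ in mB' * => eA eB.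
have [_ AA'] : ae_class mu A A' by rewrite eA; split; rewrite // setYK measure0.
have [_ BB'] : ae_class mu B B' by rewrite eB; split; rewrite // setYK measure0.
apply/eqP; rewrite eq_le; apply/andP; split.
- rewrite (le_trans (measure_setY_triangle mA' mA mB'))// setYC AA' add0e.
  by rewrite (le_trans (measure_setY_triangle mA mB mB'))// BB' adde0.
- rewrite (le_trans (measure_setY_triangle mA mA' mB))// AA' add0e.
  by rewrite (le_trans (measure_setY_triangle mA' mB' mB))// (setYC B') BB' adde0.
Qed.

Lemma d_mu_refl X : d_mu X X = 0.
Proof. by rewrite /d_mu setYK measure0 sqrte0. Qed.

Lemma d_mu_sym X Y : d_mu X Y = d_mu Y X.
Proof. by rewrite /d_mu setYC. Qed.

Lemma d_mu_eq0 X Y : d_mu X Y = 0 -> X = Y.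
Proof.
have [mX eX] := class_reprP X; have [mY eY] := class_reprP Y.
move=> /(congr1 (fun x => x ^+ 2)); rewrite /d_mu sqr_sqrte// expe2 mul0e => h.
have hYX : mu (class_repr Y `+` class_repr X) = 0 by rewrite setYC.
apply: val_inj => /=; rewrite eX eY; apply/seteqP.
split=> C [mC hC]; split=> //; apply/eqP; rewrite -measure_le0.
- by rewrite (le_trans (measure_setY_triangle mY mX mC))// hYX hC adde0.
- by rewrite (le_trans (measure_setY_triangle mX mY mC))// h hC adde0.
Qed.

Lemma d_mu_triangle X Y Z : d_mu X Z <= d_mu X Y + d_mu Y Z.
Proof.
have [mX _] := class_reprP X; have [mY _] := class_reprP Y.
have [mZ _] := class_reprP Z.
by apply: sqrte_le_add => //; exact: measure_setY_triangle.
Qed.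

Definition d_mu_ball X (e : R) : set (measure_algebra mu) :=
  [set Y | d_mu X Y < e%:E].

Lemma d_mu_ball_center X (e : R) : (0 < e)%R -> d_mu_ball X e X.
Proof. by move=> e0; rewrite /d_mu_ball /= d_mu_refl lte_fin. Qed.

Lemma d_mu_ball_sym X Y (e : R) : d_mu_ball X e Y -> d_mu_ball Y e X.
Proof. by rewrite /d_mu_ball /= d_mu_sym. Qed.

Lemma d_mu_ball_triangle X Y Z (e1 e2 : R) :
  d_mu_ball X e1 Y -> d_mu_ball Y e2 Z -> d_mu_ball X (e1 + e2)%R Z.
Proof.
rewrite /d_mu_ball /= => h1 h2.
by rewrite (le_lt_trans (d_mu_triangle X Y Z))// EFinD lteD.
Qed.

End d_mu_theory.

(* Library pseudometric spaces are given by their balls of finite radius, so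
   the value +oo of [d_mu] is harmless. *)
HB.instance Definition _ (d : measure_display) (T : measurableType d)
    (R : realType) (mu : {measure set T -> \bar R}) :=
  hasNbhs.Build (measure_algebra mu) (nbhs_ (entourage_ (@d_mu_ball d T R mu))).

HB.instance Definition _ (d : measure_display) (T : measurableType d)
    (R : realType) (mu : {measure set T -> \bar R}) :=
  Nbhs_isPseudoMetric.Build R (measure_algebra mu) erefl
    (@d_mu_ball_center d T R mu) (@d_mu_ball_sym d T R mu)
    (@d_mu_ball_triangle d T R mu) erefl.

Definition measure_algebra_fin (d : measure_display) (T : measurableType d)
    (R : realType) (mu : {measure set T -> \bar R}) :
    set (measure_algebra mu) :=
  [set X | exists (A : set T) (mA : measurable A),
     mu A < +oo /\ X = class_of mu mA].
Arguments measure_algebra_fin {d T R} mu _.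

(* Main.v *)
(* The measure of a set is the sum of the masses of the points of E_fin and
   E_inf in it. If E_fin is summable and G `<=` E_inf is finite, then every
   subset of K = E_fin `|` G is measurable, and {0,1}^E maps onto the classes
   of subsets of K by f |-> [K `&` f]; this is continuous because, up to an
   arbitrarily small mass, K is finite, so these classes form a compact set by
   Tychonoff's theorem. Taking G = E_inf yields the whole measure algebra, and
   G = set0 the classes of finite measure.
   Conversely, a compact set is covered by finitely many unit balls: their
   centers of finite measure bound the mass of all finite F `<=` E_fin, and each
   ball contains the class of at most one point of E_inf. *)
Require Import Defs.
From HB Require Import structures.
From mathcomp Require Import all_boot all_order all_algebra.
From mathcomp Require Import finmap.
From mathcomp Require Import all_classical all_reals all_analysis.
Import Order.TTheory GRing.Theory Num.Theory.
Local Open Scope classical_set_scope.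
Local Open Scope ring_scope.
Local Open Scope ereal_scope.

(** The sum is the supremum of its finite partial sums, and being finite it is approached by one of
    them to within [e]; what remains is the tail. *)
Lemma esum_tail (R : realType) (T : choiceType) (K : set T) (a : T -> \bar R)
    (e : R) :
  (forall x, K x -> 0 <= a x) -> \esum_(x in K) a x < +oo -> (0 < e)%R ->
  exists F, [/\ finite_set F, F `<=` K & \esum_(x in K `\` F) a x < e%:E].
Proof.
move=> a0 afin e0.
have Kfin : \esum_(x in K) a x \is a fin_num.
  by rewrite ge0_fin_numE//; exact: esum_ge0.
have [_ [F [finF FK] <-] Fe] := ub_ereal_sup_adherent e0 Kfin.
exists F; split => //; move: Kfin Fe; rewrite -/(esum K a).
rewrite (esumID F K a a0) setIidr// esum_fset//; last first.
  by move=> x /set_mem /FK /a0.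
rewrite -setDE fin_numD => /andP[sF tF].
by rewrite lteBlDr// lteD2lE.
Qed.

Section measure_algebra_theory.
Set Implicit Arguments.
Unset Strict Implicit.
Context (d : measure_display) (E : measurableType d) (R : realType).
Variable mu : {measure set E -> \bar R}.
Implicit Types (A B F G : set E) (X Y : measure_algebra mu).

Lemma class_of_eq A B (mA : measurable A) (mB : measurable B) :
  mu (A `+` B) = 0 -> class_of mu mA = class_of mu mB.
Proof. by move=> AB; apply: d_mu_eq0; rewrite d_muE AB sqrte0. Qed.

Lemma class_of_repr X (mX : measurable (class_repr X)) :
  class_of mu mX = X.
Proof. by apply: val_inj; rewrite /= -(class_reprP X).2. Qed.

Lemma d_mu_class_lt A B (mA : measurable A) (mB : measurable B) (e : R) :
  (0 < e)%R -> (d_mu (class_of mu mA) (class_of mu mB) < e%:E) =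
  (mu (A `+` B) < (e ^+ 2)%:E).
Proof.
move=> e0; rewrite d_muE !ltNge; congr (~~ _).
rewrite -[in RHS]lee_sqrt ?measure_ge0//.
by rewrite /= sqrtr_sqr ger0_norm// ltW.
Qed.

(** A finite cover by unit balls. The centers [D] may lie outside [K], hence may have infinite
    measure. *)
Lemma compact_net (K : set (measure_algebra mu)) : compact K ->
  exists2 D : set (measure_algebra mu), finite_set D &
    forall A (mA : measurable A), K (class_of mu mA) ->
    exists2 Y, D Y & mu (A `+` class_repr Y) < 1.
Proof.
(* [compact_cover] is only stated for pointed spaces. *)
pose pM := isPointed.Build (measure_algebra mu) (class_of mu measurable0).
pose M : ptopologicalType := HB.pack (measure_algebra mu) pM.
rewrite -[compact K]/(@compact M K) compact_cover.
move=> /(_ _ setT (fun X => interior (ball (X : measure_algebra mu) (1 : R)))).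
case=> [X _|X KX|D _ Dcov].
- exact: open_interior.
- by exists X => //; exact: nbhsx_ballx.
exists [set` D]; first exact: finite_fset.
move=> A mA /Dcov[Y YD /interior_subset YA]; exists Y => //.
have [mY _] := class_reprP Y.
by rewrite -(expr1n R 2) -d_mu_class_lt// class_of_repr d_mu_sym.
Qed.

Hypothesis mu_atomic : purely_atomic_singletons mu.

(** The members of [CC] are exactly the singletons of points of [E_fin] and [E_inf], so the sum over
    [CC] reindexes by points. *)
Lemma measure_atomicE A : measurable A ->
  mu A = \esum_(x in A `&` (E_fin mu `|` E_inf mu)) mu [set x].
Proof.
have [CC [CCat CC1 CCsum]] := mu_atomic.
have CCE x : CC [set x] -> (E_fin mu `|` E_inf mu) x.
  move=> /CCat[mx x0 _]; have [xoo|xoo] := ltP (mu [set x]) +oo.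
    by left; split => //; rewrite x0.
  by right; split => //; apply/eqP; rewrite eq_le leey.
have ECC x : (E_fin mu `|` E_inf mu) x -> CC [set x].
  move=> Ex; have [mx x0] : measurable [set x] /\ 0 < mu [set x].
    by case: Ex => [[mx /andP[]]|[mx ->]].
  (* If [[set x]] were missing, every member of [CC] would be disjoint from it, and only null terms
     would remain in the sum for its positive mass. *)
  apply: contrapT => nCC; move: x0; rewrite CCsum// esum1 ?ltxx// => C [CCC].
  have [y Cy] := CC1 _ CCC; rewrite Cy in CCC *.
  have [xy|xy] := eqVneq x y; first by rewrite -xy in CCC.
  rewrite (_ : _ `&` _ = set0) ?measure0//.
  by rewrite -subset0 => z [/= -> /eqP]; rewrite (negPf xy).
move=> mA; rewrite CCsum//; apply: reindex_esum; split.
- move=> x [Ax Ex]; split; first exact: ECC.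
  by congr (mu _); rewrite setIidr// => _ ->.
- by move=> x y _ _ xy; have : [set y] x by rewrite -xy.
- move=> C [CCC muC]; have [x Cx] := CC1 _ CCC; subst C.
  exists x => //; split; last exact: CCE.
  apply: contrapT => nAx; have [_] := CCat _ CCC.
  by rewrite -muC setI1 memNset// measure0 ltxx.
Qed.

Lemma measure_sub_atomic A K : measurable A ->
  A `&` (E_fin mu `|` E_inf mu) `<=` K -> mu A <= \esum_(x in K) mu [set x].
Proof.
move=> mA AK; rewrite measure_atomicE// esum_mkcond [leRHS]esum_mkcond.
apply: le_esum => x _; case: ifPn => [/set_mem/AK xK|_].
  by rewrite mem_set.
by case: ifP.
Qed.

Lemma finite_measurable F :
  finite_set F -> F `<=` E_fin mu `|` E_inf mu -> measurable F.
Proof.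
move=> finF FE; rewrite -[F]image_id -bigcup_imset1.
apply: fin_bigcup_measurable => //.
by move=> x /FE[][].
Qed.

(** Finite sets [F n] that leave tails below 1/(n+1) exhaust [E_fin]: a point missed by all of them
    would have zero mass. So [A] is a countable union of finite sets. *)
Lemma measurable_sub_Efin A : \esum_(x in E_fin mu) mu [set x] < +oo ->
  A `<=` E_fin mu -> measurable A.
Proof.
move=> fin_sum AE.
have /choice[F FP] (n : nat) : exists F, [/\ finite_set F, F `<=` E_fin mu &
    \esum_(x in E_fin mu `\` F) mu [set x] < (n.+1%:R^-1)%:E].
  by apply: esum_tail.
have -> : A = \bigcup_n (A `&` F n).
  apply/seteqP; split => [x Ax|x [n _ []]//]; apply: contrapT => nFx.
  have [mx /andP[x0 _]] := AE _ Ax.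
  have xn n : mu [set x] < (n.+1%:R^-1)%:E.
    have [_ _] := FP n; apply: le_lt_trans; apply: measure_sub_atomic => //.
    move=> y [-> _]; split; first exact: AE.
    by move=> Fx; apply: nFx; exists n.
  have xfin : mu [set x] \is a fin_num.
    by rewrite ge0_fin_numE// (lt_trans (xn 0%N))// ltry.
  move: x0 xn; rewrite -(fineK xfin) lte_fin => x0 xn.
  (* For this [n], [n.+1] exceeds the inverse of the mass, so 1/(n+1) is at most the mass. *)
  have := xn (Num.truncn (fine (mu [set x]))^-1); rewrite lte_fin; apply/negP.
  rewrite -leNgt -[leRHS]invrK lef_pV2 ?posrE ?invr_gt0//.
  exact/ltW/Num.Theory.truncnS_gt.
apply: bigcupT_measurable => n; have [finF FE _] := FP n.
apply: finite_measurable; first exact: finite_setIr.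
by move=> x [_ /FE]; left.
Qed.

Lemma compact_subsets G : \esum_(x in E_fin mu) mu [set x] < +oo ->
  finite_set G -> G `<=` E_inf mu ->
  compact [set X | exists A (mA : measurable A),
    A `<=` E_fin mu `|` G /\ X = class_of mu mA].
Proof.
move=> fin_sum finG GE; set K := E_fin mu `|` G.
have mK A : A `<=` K -> measurable A.
  move=> AK; rewrite -(setIidl AK) setIUr; apply: measurableU.
    by apply: measurable_sub_Efin => // x [].
  apply: finite_measurable; first exact: finite_setIr.
  by move=> x [_ /GE]; right.
have mf (f : prod_topology (fun _ : E => bool)) :
    measurable (K `&` [set x | f x]) by apply: mK.
pose Phi f : measure_algebra mu := class_of mu (mf f).
have -> : [set X | exists A (mA : measurable A), A `<=` K /\ X = class_of mu mA]
    = Phi @` [set f | forall x : E, [set: bool] (f x)].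
  apply/seteqP; split => [_ [A [mA [AK ->]]]|_ [f _ <-]] /=; last first.
    by exists (K `&` [set x | f x]), (mf f); split => // x [].
  exists (fun x => x \in A) => //; apply: class_of_eq.
  rewrite (_ : [set x | _] = A) ?(setIidr AK) ?setYK ?measure0//.
  by apply/seteqP; split => x /= /[!inE].
apply: (@continuous_compact (prod_topology (fun _ : E => bool)) _ Phi);
  last first.
  by apply: (@tychonoff E (fun=> bool) (fun=> setT)) => _; exact: bool_compact.
apply: continuous_subspaceT => f.
apply/fcvg_ballP => e e0.
(* The bound is [e ^+ 2] because [d_mu] is a square root. *)
have [F [finF FE Fe]] : exists F, [/\ finite_set F, F `<=` E_fin mu &
    \esum_(x in E_fin mu `\` F) mu [set x] < (e ^+ 2)%:E].
  by apply: esum_tail => //; rewrite exprn_gt0.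
have finFG : finite_set (F `|` G) by rewrite finite_setU.
(* Agreement with [f] at finitely many coordinates is a neighbourhood of [f], as [bool] is discrete.
   Points of [G] are included since a single disagreement there costs infinite mass. *)
have fg : \forall g \near f, (\bigcap_(x in [set` fset_set (F `|` G)])
    [set g | g x = f x]) g.
  apply: filter_bigI => x _.
  exact: (@proj_continuous E (fun=> bool) x f _ (discrete_set1 (f x))).
apply: filterS fg => g; rewrite fset_setK// => fg.
rewrite /ball/= /d_mu_ball/= d_mu_class_lt//; apply: le_lt_trans Fe.
apply: measure_sub_atomic; first exact: measurable_setY.
move=> x [fgx _]; have [Kx nfg] : K x /\ f x <> g x.
  by case: fgx => -[[Kx /= fx] nKg]; split => // fgx; apply: nKg; split => //;
    rewrite /= ?fgx// -fgx.
have nFGx : ~ (F `|` G) x by move=> /fg; exact/nesym.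
by case: Kx => [Ex|Gx]; [split => // Fx|]; exfalso; apply: nFGx; [left|right].
Qed.

Lemma measure_finite_Efin F : finite_set F -> F `<=` E_fin mu ->
  mu F = \sum_(x \in F) mu [set x].
Proof.
move=> finF FE; have FEU : F `<=` E_fin mu `|` E_inf mu by move=> x /FE; left.
rewrite measure_atomicE ?setIidl ?esum_fset//.
exact: finite_measurable.
Qed.

Lemma esum_Efin_lty (K : set (measure_algebra mu)) :
  compact K -> measure_algebra_fin mu `<=` K ->
  \esum_(x in E_fin mu) mu [set x] < +oo.
Proof.
move=> /compact_net[D finD DK] finK.
(* Discarding the centers of infinite measure keeps [M] finite; a center close to a set of finite
   measure is never discarded. *)
pose D' := D `&` [set Y | mu (class_repr Y) < +oo].
have finD' : finite_set D' by exact: finite_setIl.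
pose M := \sum_(Y \in D') mu (class_repr Y).
have Moo : M < +oo.
  rewrite /M fsbig_finite//= big_seq; apply: lte_sum_pinfty => Y.
  by rewrite in_fset_set// => /set_mem[].
apply: (@le_lt_trans _ _ (M + 1)); last by rewrite lte_add_pinfty// ltry.
apply: ge_ereal_sup => _ [F [finF FE] <-].
have mF : measurable F.
  by apply: finite_measurable => // x /FE; left.
have Foo : mu F < +oo.
  rewrite measure_finite_Efin// fsbig_finite//= big_seq.
  apply: lte_sum_pinfty => x.
  by rewrite in_fset_set// => /set_mem/FE[_ /andP[]].
have [|Y DY FY1] := DK _ mF; first by apply: finK; exists F, mF.
rewrite -measure_finite_Efin//; have [mY _] := class_reprP Y.
(* Taking the empty set as third vertex bounds [mu F] by the measure of [Y], and conversely. *)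
have FY := measure_setY_triangle mu mF mY measurable0.
have YF := measure_setY_triangle mu mY mF measurable0.
rewrite !setY0 in FY YF.
apply: (le_trans FY); rewrite addeC leeD ?(ltW FY1)//.
have D'Y : D' Y.
  split => //=; apply: (le_lt_trans YF).
  by rewrite lte_add_pinfty// setYC (lt_trans FY1)// ltry.
have <- : \sum_(Z \in [set Y]) mu (class_repr Z) = mu (class_repr Y).
  exact: fsbig_set1.
by apply: lee_fsum_nneg_subset => // Z /[!inE] ->.
Qed.

Lemma finite_Einf : compact [set: measure_algebra mu] -> finite_set (E_inf mu).
Proof.
move=> /compact_net[D finD DT].
(* [f] recovers a point of [E_inf] from a nearby center, so [E_inf] lies in the image of [D]; the
   default [point] is harmless. *)
pose f Y :=
  xget point [set x | E_inf mu x /\ mu ([set x] `+` class_repr Y) < 1].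
apply: (sub_finite_set _ (finite_image f finD)) => x Ex.
have [mx _] := Ex; have [//|Y DY xY] := DT _ mx; exists Y => //.
have xY_in y : E_inf mu y -> mu ([set y] `+` class_repr Y) < 1 ->
    class_repr Y y.
  move=> [my yoo]; apply: contraPP => nYy; apply/negP; rewrite -leNgt.
  rewrite (@le_trans _ _ (mu [set y])) ?yoo ?leey// -yoo.
  have [mY _] := class_reprP Y.
  apply: le_measure; rewrite ?inE//; first exact: measurable_setY.
  by move=> _ ->; left.
(* If [y] differed from [x], then [x], which lies in [Y], would put infinite mass in the symmetric
   difference of [[set y]] and [Y]. *)
apply: xget_unique => //= y [Ey yY]; apply: contrapT => xy.
have := yY; apply/negP; rewrite -leNgt; have [_ xoo] := Ex.
rewrite (@le_trans _ _ (mu [set x])) ?xoo ?leey// -xoo.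
have [mY _] := class_reprP Y.
apply: le_measure; rewrite ?inE//.
  by apply: measurable_setY => //; have [] := Ey.
by move=> _ ->; right; split; [exact: xY_in|exact/nesym].
Qed.

(** The part of [A] removed contains no point of positive mass, so it is null. This gives each class
    a representative inside [K]. *)
Lemma class_of_setI A K (mA : measurable A) (mAK : measurable (A `&` K)) :
  A `&` (E_fin mu `|` E_inf mu) `<=` K -> class_of mu mA = class_of mu mAK.
Proof.
move=> AK; apply: class_of_eq; apply/eqP; rewrite -measure_le0.
rewrite -(@esum_set0 R E (fun x => mu [set x])).
apply: measure_sub_atomic; first exact: measurable_setY.
move=> x [[[Ax nAK]|[[Ax _] //]] Ex].
by apply: nAK; split => //; exact: AK.
Qed.

End measure_algebra_theory.

Theorem theorem3p9 (d : measure_display) (E : measurableType d) (R : realType)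
    (mu : {measure set E -> \bar R})
    (mu_atomic : purely_atomic_singletons mu) :
  (compact [set: measure_algebra mu] <->
     \esum_(x in E_fin mu) mu [set x] < +oo /\ finite_set (E_inf mu)) /\
  (compact (measure_algebra_fin mu) <->
     \esum_(x in E_fin mu) mu [set x] < +oo).
Proof.
split; split.
- by move=> cT; split; [exact: esum_Efin_lty cT _|exact: finite_Einf].
- move=> [fin_sum fin_inf].
  have mK A : measurable A -> measurable (A `&` (E_fin mu `|` E_inf mu)).
    move=> mA; apply: measurableI => //; apply: measurableU.
      exact: measurable_sub_Efin mu_atomic _ fin_sum (@subset_refl _ _).
    by apply: finite_measurable => // x; right.
  have := compact_subsets mu_atomic fin_sum fin_inf (@subset_refl _ _).
  congr compact; apply/seteqP; split => // X _.
  have [mX _] := class_reprP X.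
  exists (class_repr X `&` (E_fin mu `|` E_inf mu)), (mK _ mX).
  split; first exact: subIsetr.
  by rewrite -(class_of_setI mu_atomic mX)// ?class_of_repr// => x [].
- by move=> cfin; exact: esum_Efin_lty cfin _.
- move=> fin_sum.
  have := compact_subsets mu_atomic fin_sum (@finite_set0 E) (@sub0set _ _).
  congr compact; rewrite setU0; apply/seteqP; split => [X [A [mA [AE ->]]]|].
    exists A, mA; split => //; apply: le_lt_trans fin_sum.
    by apply: (measure_sub_atomic mu_atomic) => // x [/AE].
  move=> _ [A [mA [Aoo ->]]].
  have mAE : measurable (A `&` E_fin mu).
    by apply: (measurable_sub_Efin mu_atomic) => // x [].
  exists (A `&` E_fin mu), mAE; split; first exact: subIsetr.
  (* A set of finite measure contains no point of [E_inf], so cutting it down to [E_fin] keeps its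
     class. *)
  apply: (class_of_setI mu_atomic) => // x [Ax [//|[mx xoo]]].
  move: Aoo; rewrite ltNge -xoo => /negP[].
  by apply: le_measure; rewrite ?inE// => _ ->.
Qed.
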